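(* Let $M=(\Sigma,T,\tilde s)$ be a system with finitely many reachable states and let $I$ be an unconditional independence relation on $M$. The set of unfolding prefixes of $M$ under $I$, ordered by the prefix relation $\sqsubseteq$, has a unique $\sqsubseteq$-maximal element $\mathcal{U}_{M,I}$ (the unfolding). Furthermore, for every non-empty run $\sigma$ of $M$ there exists a unique configuration $C$ of $\mathcal{U}_{M,I}$ such that $\sigma\in\mathrm{inter}(C)$.
   Context: A system is a tuple $M=(\Sigma,T,\tilde s)$ where $\Sigma$ is a set of global states, $T$ a set of transitions, each $t\in T$ being a partial function $\Sigma\to\Sigma$, and $\tilde s\in\Sigma$ the initial state. $t$ is enabled at $s$ if $t(s)$ is defined, and then $s\xrightarrow{t}t(s)$. For $\sigma=t_1\cdots t_n\in T^*$, $s\xrightarrow{\sigma}s'$ means there are states with $s\xrightarrow{t_1}s_1\cdots s_{n-1}\xrightarrow{t_n}s'$. A run is any $\sigma\in T^*$ with $\tilde s\xrightarrow{\sigma}s$ for some $s$; then $\mathrm{state}(\sigma)=s$. $\mathrm{reach}(M)$ is the set of states reached by runs. Transitions $t,t'$ commute at $s$ iff (i) if $t$ is enabled at $s$ and $s\xrightarrow{t}s'$, then $t'$ is enabled at $s$ iff it is enabled at $s'$; and (ii) if $t,t'$ are both enabled at $s$, there is $s'$ with $s\xrightarrow{tt'}s'$ and $s\xrightarrow{t't}s'$. An unconditional independence relation is a symmetric irreflexive $I\subseteq T\times T$ such that $t\,I\,t'$ implies $t,t'$ commute at every reachable state; $t,t'$ are dependent ($t\,D\,t'$) if not $t\,I\,t'$.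 A labelled event structure (LES) is $\mathcal E=(E,<,\#,h)$ with $<$ a strict partial order on $E$ (causality), $\#$ a symmetric irreflexive relation (conflict), $h$ a labelling, such that $\{e':e'<e\}$ is finite for all $e$, and $e\#e'$, $e'<e''$ imply $e\#e''$. Causes: $\lceil e\rceil=\{e':e'<e\}$; local configuration $[e]=\lceil e\rceil\cup\{e\}$. A configuration is a finite causally closed conflict-free set of events. $e,e'$ are in immediate conflict if $e\#e'$ and both $\lceil e\rceil\cup[e']$ and $[e]\cup\lceil e'\rceil$ are configurations. $\mathcal E\sqsubseteq\mathcal E'$ (prefix) iff $E\subseteq E'$, $<,\#,h$ are the restrictions of $<',\#',h'$ to $E$, and $E$ is causally closed in $\mathcal E'$. For a configuration $C$, $\mathrm{inter}(C)$ is the set of words $h(e_1)\cdots h(e_n)$ where $e_1,\dots,e_n$ enumerates $C$ and $e_i<e_j$ implies $i<j$ (the label of the special event $\bot$ is the empty word). For a configuration $H$ of an unfolding prefix, $\mathrm{state}(H)$ is $\mathrm{state}(\sigma)$ for any $\sigma\in\mathrm{inter}(H)$. Events of unfolding prefixes are pairs $\langle t,H\rangle$ with $t\in T$ and $H$ a configuration. Given an LES $\mathcal E$ and $t\in T$, the candidate histories $\mathcal H_{\mathcal E,t}$ are the configurations $H$ of $\mathcal E$ such that $t$ is enabled at $\mathrm{state}(H)$ and either $H=\{\bot\}$ or every $<$-maximal $e\in H$ satisfies $h(e)\,D\,t$. For $e=\langle t,H\rangle$, $\mathcal K_{\mathcal E,e}$ is the set of events $e'$ of $\mathcal E$ with $e'\notin[e]$,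 $e\notin[e']$, $t\,D\,h(e')$. The finite unfolding prefixes form the smallest set of LES such that: (1) the LES with the single event $\bot$, empty causality and conflict, and $h(\bot)=\varepsilon$ is one; (2) if $\mathcal E$ is one and $H\in\mathcal H_{\mathcal E,t}$, then extending $\mathcal E$ with a new event $e=\langle t,H\rangle$ with $e'<e$ for all $e'\in H$, $e\#e'$ for all $e'\in\mathcal K_{\mathcal E,e}$, and $h(e)=t$, gives one. For a set $F=\{(E_i,<_i,\#_i,h_i)\}$ of unfolding prefixes, $\biguplus F$ is the LES with events $\bigcup E_i$, causality $\bigcup<_i$, labelling $\bigcup h_i$, and conflict the smallest relation closed under conflict inheritance containing all pairs $e,e'$ with $e\notin[e']$, $e'\notin[e]$, $h(e)\,D\,h(e')$ (events are equal iff they are the same pair $\langle t,H\rangle$). Unfolding prefixes are the finite unfolding prefixes together with $\biguplus X$ for every infinite set $X$ of unfolding prefixes.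
   Formalization: Candidate histories are required to be nonempty (an empty history would give events not above ⊥ and break uniqueness of C), and the conflicts added in a one-step extension are closed under symmetry and conflict inheritance so that the result is an LES. *)

(* Defs.v *)
From HB Require Import structures.
From mathcomp Require Import all_boot finmap.
From mathcomp Require Import boolp classical_sets functions cardinality.

Set Implicit Arguments.
Unset Strict Implicit.
Unset Printing Implicit Defensive.

Local Open Scope fset_scope.
Local Open Scope classical_set_scope.

(* Transitions are indexed by [T]: [step M t] is the partial function named
   [t].  A set of partial functions is the case where [step M] is injective. *)
Record system (St T : Type) := System {
  step : T -> St -> option St;
  init : St
}.

Section Systems.
Variables (St T : Type) (M : system St T).
Implicit Types (t : T) (w : seq T) (s : St) (I : T -> T -> Prop).

Definition enabled t s : Prop := exists s', step M t s = Some s'.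

Fixpoint exec w s : option St :=
  if w is t :: w' then obind (exec w') (step M t s) else Some s.

Definition is_run w : Prop := exists s, exec w (init M) = Some s.

Definition reach : set St := [set s | exists w, exec w (init M) = Some s].

Definition commute t t' s : Prop :=
  (forall s', step M t s = Some s' -> (enabled t' s <-> enabled t' s')) /\
  (enabled t s -> enabled t' s ->
   exists s', exec [:: t; t'] s = Some s' /\ exec [:: t'; t] s = Some s').

Definition unconditional_independence I : Prop :=
  [/\ forall t t', I t t' -> I t' t,
      forall t, ~ I t t
    & forall t t', I t t' -> forall s, reach s -> commute t t' s].

Definition dependent I t t' : Prop := ~ I t t'.

End Systems.

(* The events live in a fixed universe [E]; [label X e] is [None] exactly when
   [e] is not an event of [X], so that a structure is determined by its sets of
   events, causality and conflict pairs, and the graph of its labelling. *)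
Record les (E L : Type) := Les {
  events : set E;
  causality : E -> E -> Prop;
  conflict : E -> E -> Prop;
  label : E -> option L;
  causality_events : forall e e', causality e e' -> events e /\ events e';
  conflict_events : forall e e', conflict e e' -> events e /\ events e';
  label_events : forall e, events e <-> label e <> None;
  causality_irr : forall e, ~ causality e e;
  causality_trans : forall e e' e'',
    causality e e' -> causality e' e'' -> causality e e'';
  causes_finite : forall e, finite_set [set e' | causality e' e];
  conflict_irr : forall e, ~ conflict e e;
  conflict_sym : forall e e', conflict e e' -> conflict e' e;
  conflict_inherit : forall e e' e'',
    conflict e e' -> causality e' e'' -> conflict e e''
}.

(* Least symmetric relation containing [R] and inherited along [lt]. *)
Inductive conflict_closure (E : Type) (lt R : E -> E -> Prop) :
    E -> E -> Prop :=
| conflict_base a b : R a b -> conflict_closure lt R a b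
| conflict_swap a b : conflict_closure lt R a b -> conflict_closure lt R b a
| conflict_down a b c :
    conflict_closure lt R a b -> lt b c -> conflict_closure lt R a c.

Section EventStructures.
Variables (E : choiceType) (L : Type).
Implicit Types (X Y : les E L) (C : {fset E}).

Definition causes X e : set E := [set e' | causality X e' e].

Definition local_configuration X e : set E := causes X e `|` [set e].

Definition configuration X C : Prop :=
  [/\ forall e, e \in C -> events X e,
      forall e e', e \in C -> causality X e' e -> e' \in C
    & forall e e', e \in C -> e' \in C -> ~ conflict X e e'].

Definition maximal_in X C e : Prop :=
  e \in C /\ forall e', e' \in C -> ~ causality X e e'.

Definition prefix_of X Y : Prop :=
  [/\ events X `<=` events Y,
      forall e e', causality X e e' <->
        [/\ events X e, events X e' & causality Y e e'],
      forall e e', conflict X e e' <->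
        [/\ events X e, events X e' & conflict Y e e'],
      forall e, events X e -> label X e = label Y e
    & forall e e', events X e -> causality Y e' e -> events X e'].

Definition maximal_prefix (P : set (les E L)) X : Prop :=
  P X /\ forall Y, P Y -> prefix_of X Y -> Y = X.

End EventStructures.

(* Labels are words: one-letter words for transitions, the empty word for the
   bottom event. *)
Definition inter (E : choiceType) (T : Type) (X : les E (seq T))
    (C : {fset E}) : set (seq T) :=
  [set w | exists s : seq E,
    [/\ uniq s, s =i C,
        forall e e', e \in C -> e' \in C -> causality X e e' ->
          (index e s < index e' s)%N
      & w = flatten (pmap (label X) s)]].

(* Raw terms; the pair <t, H> is [Ev t H] below. *)
Inductive event (T : Type) : Type :=
| Bot : event T
| EvSeq : T -> seq (event T) -> event T.
Arguments Bot {T}.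

Section EventChoice.
Variable T : Type.

Fixpoint event_encode (e : event T) : GenTree.tree T :=
  match e with
  | Bot => GenTree.Node 0 [::]
  | EvSeq t s => GenTree.Node 1 (GenTree.Leaf t :: map event_encode s)
  end.

Fixpoint event_decode (x : GenTree.tree T) : option (event T) :=
  match x with
  | GenTree.Node 0 _ => Some Bot
  | GenTree.Node _ (GenTree.Leaf t :: s) =>
      Some (EvSeq t (pmap event_decode s))
  | _ => None
  end.

Lemma event_encodeK : pcancel event_encode event_decode.
Proof.
rewrite /pcancel; fix IH 1 => -[|t s]; first exact: erefl.
rewrite /=; congr (Some (EvSeq t _)).
elim: s => [|e s IHs]; first exact: erefl.
by rewrite /= IH /= IHs.
Qed.

End EventChoice.

HB.instance Definition _ (T : choiceType) :=
  Choice.copy (event T) (pcan_type (@event_encodeK T)).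

(* [enum_fset H] is the canonical duplicate-free enumeration of [H], so [Ev] is
   injective and events are equal iff they are the same pair. *)
Definition Ev (T : choiceType) (t : T) (H : {fset event T}) : event T :=
  EvSeq t (enum_fset H).

Lemma Ev_inj (T : choiceType) (t t' : T) (H H' : {fset event T}) :
  Ev t H = Ev t' H' -> t = t' /\ H = H'.
Proof. by case=> -> eqH; split=> //; apply: val_inj. Qed.

Section Unfolding.
Variables (St : Type) (T : choiceType) (M : system St T).
Variable I : T -> T -> Prop.

Notation ules := (les (event T) (seq T)).
Implicit Types (X Y : ules) (F : set ules) (H : {fset event T}).

(* Well defined for configurations of unfolding prefixes, where all the words
   of [inter X H] are runs reaching the same state. *)
Definition state_of X H (s : St) : Prop :=
  exists2 w, inter X H w & exec M w (init M) = Some s.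

(* [H] must be nonempty: the maximality condition holds vacuously of the empty
   configuration, which would yield events that are not caused by [Bot]. *)
Definition candidate_history X (t : T) H : Prop :=
  [/\ configuration X H,
      H <> fset0,
      exists2 s, state_of X H s & enabled M t s
    & H = [fset Bot] \/
      forall e, maximal_in X H e ->
        exists2 u, label X e = Some [:: u] & dependent I u t].

Definition labels_dependent X (e e' : event T) : Prop :=
  exists t t', [/\ label X e = Some [:: t], label X e' = Some [:: t']
                 & dependent I t t'].

Definition incomparable_dependent X (e e' : event T) : Prop :=
  [/\ events X e, events X e',
      ~ local_configuration X e e', ~ local_configuration X e' e
    & labels_dependent X e e'].

Definition is_bottom X : Prop :=
  [/\ events X = [set Bot],
      forall e e', ~ causality X e e',
      forall e e', ~ conflict X e e'
    & label X Bot = Some [::]].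

(* The new conflicts [incomparable_dependent Y (Ev t H)] are those of
   K_(X, <t,H>); they are closed under inheritance because the result has to
   be a labelled event structure. *)
Definition is_extension X (t : T) H Y : Prop :=
  [/\ ~ events X (Ev t H),
      events Y = events X `|` [set Ev t H],
      forall a b, causality Y a b <->
        causality X a b \/ (a \in H /\ b = Ev t H),
      forall a b, conflict Y a b <->
        conflict_closure (causality Y)
          (fun c d => conflict X c d \/
                      (c = Ev t H /\ incomparable_dependent Y c d)) a b
    & forall e, label Y e =
        if e == Ev t H then Some [:: t] else label X e].

Inductive finite_unfolding_prefix : set ules :=
| finite_prefix_bottom X : is_bottom X -> finite_unfolding_prefix X
| finite_prefix_extend X t H Y :
    finite_unfolding_prefix X -> candidate_history X t H ->
    is_extension X t H Y -> finite_unfolding_prefix Y.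

Definition is_union F Y : Prop :=
  [/\ events Y = \bigcup_(X in F) events X,
      forall a b, causality Y a b <-> exists2 X, F X & causality X a b,
      forall a b, conflict Y a b <->
        conflict_closure (causality Y) (incomparable_dependent Y) a b
    & forall e l, label Y e = Some l <->
        exists2 X, F X & label X e = Some l].

Inductive unfolding_prefix : set ules :=
| unfolding_prefix_finite X : finite_unfolding_prefix X -> unfolding_prefix X
| unfolding_prefix_union F Y :
    infinite_set F -> (forall X, F X -> unfolding_prefix X) ->
    is_union F Y -> unfolding_prefix Y.

End Unfolding.

(* Main.v *)
Require Import Defs.
From mathcomp Require Import all_boot finmap.
From mathcomp Require Import boolp classical_sets functions cardinality.

(* Causality, labels and conflict of an unfolding prefix can be read off the raw
   event terms: a causally precedes <t, H> iff a is in H, and two events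
   conflict iff they have incomparable causal predecessors with dependent
   labels.  Hence prefixes correspond to the causally closed sets, containing
   the bottom event, of hereditarily well-formed events, and the largest of
   these sets is the unfolding.  A finite one is built by adding its events in
   causal order; an infinite one is the union of its finite subprefixes.

   All linearizations of a configuration are runs reaching the same state,
   since maximal events of a configuration are pairwise independent.  A run wt
   extends the configuration C of w by the event <t, H>, where H consists of
   the causal predecessors in C of the events dependent on t; this H is forced,
   which gives uniqueness. *)

Section Prefixes.
Set Implicit Arguments.
Unset Strict Implicit.
Unset Printing Implicit Defensive.
Local Open Scope fset_scope.
Local Open Scope classical_set_scope.

Variables (St : Type) (T : choiceType) (M : system St T) (I : T -> T -> Prop).
Hypothesis indep : unconditional_independence M I.
Implicit Types (a b c e x y : event T) (t u : T) (s p q : seq (event T)).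
Implicit Types (H : {fset event T}) (D : set (event T)).

Let indepC t u : I t u -> I u t. Proof. by case: indep => + _ _; apply. Qed.

(** * Executing words of independent transitions *)

Lemma exec_cat w w' (o : St) :
  exec M (w ++ w') o = obind (exec M w') (exec M w o).
Proof. by elim: w o => //= t w IH o; case: (step M t o) => //=. Qed.

(** Clause (i) of commutation applied along [w]; every state met on the way is reachable because [o]
    is. *)
Lemma enabled_exec_indep t w (o o' : St) :
    reach M o -> exec M w o = Some o' -> (forall u, u \in w -> I u t) ->
  enabled M t o <-> enabled M t o'.
Proof.
elim: w o => [|u w IH] o ro /=; first by case=> ->.
case E: (step M u o) => [o1|] //= E1 Iw.
have [com _] : Defs.commute M u t o.
  by case: indep => _ _; apply=> //; apply: Iw; rewrite inE eqxx.
rewrite (com _ E); apply: IH => // [|v vw]; last by apply: Iw; rewrite inE vw orbT.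
by case: ro => v Ev; exists (rcons v u); rewrite -cats1 exec_cat Ev /= E.
Qed.

(** * Events as terms *)

Fixpoint event_size e : nat :=
  if e is EvSeq _ s then (sumn (map event_size s)).+1 else 0.

(** Plain membership in the history. Transitivity is available for valid events, whose histories are
    causally closed. *)
Definition cau a b : bool := if b is EvSeq _ s then a \in s else false.

Definition lab e : seq T := if e is EvSeq t _ then [:: t] else [::].

Lemma cau_Ev a t H : cau a (Ev t H) = (a \in H). Proof. by []. Qed.

Lemma cau_size a b : cau a b -> (event_size a < event_size b)%N.
Proof.
case: b => //= t s; elim: s => //= b s IH; rewrite inE => /orP[/eqP->|/IH].
  by rewrite ltnS leq_addr.
by rewrite !ltnS => /leq_trans; apply; rewrite leq_addl.
Qed.

Lemma cau_irr e : cau e e = false.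
Proof. by apply/negP => /cau_size; rewrite ltnn. Qed.

Definition inc a b : Prop :=
  [/\ a <> b, ~ cau a b, ~ cau b a &
      exists t u, [/\ lab a = [:: t], lab b = [:: u] & ~ I t u]].

Lemma incC a b : inc a b -> inc b a.
Proof.
case=> ab nab nba [t [u [ta ub dtu]]]; split; rewrite ?nab //.
  by move=> eba; apply: ab.
by exists u, t; split=> // /indepC.
Qed.

Definition ordered s := uniq s && pairwise (fun a b => ~~ cau b a) s.

Definition word s : seq T := flatten (map lab s).

Lemma word_rcons s e : word (rcons s e) = word s ++ lab e.
Proof. by rewrite /word map_rcons flatten_rcons. Qed.

Lemma word_cat s s' : word (s ++ s') = word s ++ word s'.
Proof. by rewrite /word map_cat flatten_cat. Qed.

Definition runs s : option St := exec M (word s) (init M).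

Lemma runs_rcons s e : runs (rcons s e) = obind (exec M (lab e)) (runs s).
Proof. by rewrite /runs word_rcons exec_cat. Qed.

Lemma runs_reach s o : runs s = Some o -> reach M o.
Proof. by exists (word s). Qed.

Definition down_closed D := forall e x, D e -> cau x e -> D x.

Definition inc_free D := forall a b, D a -> D b -> ~ inc a b.

(** The conditions of [candidate_history] on bare terms. [inc_free] stands for conflict-freeness: in
    a causally closed set, an inherited conflict comes from an incomparable dependent pair of
    members. *)
Definition history t H : Prop :=
  [/\ down_closed [set` H], inc_free [set` H], H <> fset0,
      exists s, [/\ ordered s, s =i H &
                    exists2 o, runs s = Some o & enabled M t o]
    & H = [fset Bot] \/
      forall e, e \in H -> (forall x, x \in H -> ~ cau e x) ->
        exists2 u, lab e = [:: u] & ~ I u t].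

Inductive valid : event T -> Prop :=
| valid_Bot : valid Bot
| valid_Ev t H : (forall x, x \in H -> valid x) -> history t H ->
    valid (Ev t H).

Lemma valid_inv e : valid e -> e = Bot \/
  exists t H, [/\ e = Ev t H, forall x, x \in H -> valid x & history t H].
Proof. by case=> [|t H Hv hH]; [left | right; exists t, H]. Qed.

Lemma valid_EvE t H : valid (Ev t H) ->
  (forall x, x \in H -> valid x) /\ history t H.
Proof.
by case/valid_inv => [//|[t' [H' [/Ev_inj[-> ->]]]]].
Qed.

Lemma cau_trans a b c : valid c -> cau a b -> cau b c -> cau a c.
Proof.
by case/valid_inv => [->//|[t [H [-> _ [+ _ _ _ _]]]]] ab bc; apply; first exact: bc.
Qed.

Lemma valid_cau a b : valid b -> cau a b -> valid a.
Proof. by case/valid_inv => [->//|[t [H [-> + _]]]]; apply. Qed.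

(** A history is nonempty and causally closed, so any of its members brings in [Bot]. *)
Lemma cau_Bot e : valid e -> e = Bot \/ cau Bot e.
Proof.
elim=> [|t H _ IH [closed _ nonempty _ _]]; [by left | right].
have [//|[x xH]] := fset_0Vmem H.
by case: (IH _ xH) => [<-//|Bx]; apply: (closed x).
Qed.

Lemma Bot_closed D e : down_closed D -> D e -> valid e -> D Bot.
Proof. by move=> cD De /cau_Bot[<-//|]; apply: cD. Qed.

(** Climbing from [e] terminates, since sizes grow along causality and stay below that of [Ev t H];
    [t] is there to form this bound. *)
Lemma cau_maximal H t e : (forall x, x \in H -> valid x) -> e \in H ->
  exists m, [/\ m \in H, e = m \/ cau e m & forall x, x \in H -> ~ cau m x].
Proof.
move=> vH; have [k] := ubnP (event_size (Ev t H) - event_size e).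
elim: k e => // k IH e lek eH.
have [mx|] := pselect (forall x, x \in H -> ~ cau e x).
  by exists e; split=> //; left.
move=> /existsNP[x /not_implyP[xH /contrapT ex]].
have [|//|m [mH xm mx]] := IH x.
  have := cau_size ex; have := @cau_size x (Ev t H) xH; move: lek; rewrite ltnS.
  move: (event_size _) (event_size _) (event_size _) => i j l le1 lt1 lt2.
  apply: leq_trans le1; apply: ltn_sub2l => //; exact: ltn_trans lt1.
exists m; split=> //; right; case: xm => [<-//|].
by apply: cau_trans => //; apply: vH.
Qed.

(** * Linearizations of configurations *)

Definition configuration_events D :=
  [/\ forall e, D e -> valid e, down_closed D & inc_free D].

Definition lin s := ordered s /\ configuration_events [set` s].

Lemma lin_rcons p e : lin (rcons p e) <->
  [/\ lin p, e \notin p, valid e, forall x, cau x e -> x \in p &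
      forall x, x \in p -> ~ cau e x /\ ~ inc x e].
Proof.
rewrite /lin /ordered rcons_uniq pairwise_rcons; split.
  case=> /andP[/andP[ep up] /andP[/allP ae pp]] [vp cp ip].
  have inp x : x \in p -> x \in rcons p e by rewrite mem_rcons inE orbC => ->.
  have ine : e \in rcons p e by rewrite mem_rcons inE eqxx.
  have cxe x : cau x e -> x \in p.
    move=> xe; have /= := cp e x ine xe; rewrite mem_rcons inE => /orP[/eqP E|//].
    by move: xe; rewrite E cau_irr.
  split=> //.
  - split; first by rewrite up pp.
    split.
    + by move=> x /inp/vp.
    + move=> x y /= xp yx; have /= := cp x y (inp _ xp) yx.
      rewrite mem_rcons inE => /orP[/eqP E|//].
      by have := ae _ xp; rewrite -E yx.
    + by move=> x y /inp + /inp; apply: ip.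
  - exact: vp.
  - by move=> x xp; split; [apply/negP/ae | apply: ip => //; apply: inp].
case=> -[/andP[up pp] [vp cp ip]] ep ve ce me; rewrite ep up pp /= andbT.
split; first by apply/allP => x /me[/negP].
split.
- by move=> x /=; rewrite mem_rcons inE => /orP[/eqP->|/vp].
- move=> x y /=; rewrite !mem_rcons !inE => /orP[/eqP->/ce->|xp yx].
    by rewrite orbT.
  by rewrite (cp x y xp yx : y \in p) orbT.
- move=> a b /=; rewrite !mem_rcons !inE.
  move=> /orP[/eqP->|ap] /orP[/eqP->|bp].
  + by case.
  + by move/incC; case: (me b bp).
  + by case: (me a ap).
  + exact: ip.
Qed.

Lemma ordered_filter (P : pred (event T)) s : ordered s -> ordered (filter P s).
Proof. by case/andP=> us ps; rewrite /ordered filter_uniq ?pairwise_filter. Qed.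

Lemma lin_sub s s' : lin s -> ordered s' -> {subset s' <= s} ->
  down_closed [set` s'] -> lin s'.
Proof.
move=> [_ [vs _ is_]] os ss cs; split=> //; split=> //.
  by move=> e /ss /vs.
by move=> a b /ss + /ss; apply: is_.
Qed.

Lemma lin_filter (P : pred (event T)) s : lin s ->
  (forall e x, e \in s -> P e -> cau x e -> P x) -> lin (filter P s).
Proof.
move=> ls cP; apply: (lin_sub ls); first by apply: ordered_filter; case: ls.
  by move=> x; rewrite mem_filter => /andP[].
move=> e x /=; rewrite !mem_filter => /andP[Pe es] xe.
by rewrite (cP e) //=; case: ls => _ [_ cs _]; apply: cs es xe.
Qed.

(** An event of [P] has no cause outside [P], so moving [P] to the front breaks no causal
    constraint. *)
Lemma lin_split (P : pred (event T)) s : lin s ->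
  (forall e x, e \in s -> P e -> cau x e -> P x) ->
  lin (filter P s ++ filter (predC P) s) /\
  filter P s ++ filter (predC P) s =i s.
Proof.
move=> ls cP.
have E : filter P s ++ filter (predC P) s =i s.
  by move=> x; rewrite mem_cat !mem_filter /= -andb_orl orbN.
split=> //; apply: (lin_sub ls).
- case: ls => /andP[us ps] _.
  rewrite /ordered pairwise_cat !pairwise_filter // cat_uniq !filter_uniq //=.
  rewrite !andbT; apply/andP; split.
    by apply/hasPn => x; rewrite !mem_filter /= => /andP[/negbTE->].
  apply/allrelP => x y; rewrite !mem_filter /= => /andP[Px xs] /andP[nPy _].
  by apply: contra nPy; apply: cP xs Px.
- by move=> x; rewrite E.
- by case: ls => _ [_ cs _] e x /=; rewrite !E; apply: cs.
Qed.

Lemma lin_last e s : lin s -> e \in s -> (forall x, x \in s -> ~ cau e x) ->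
  lin (rcons (filter (predC1 e) s) e) /\
  rcons (filter (predC1 e) s) e =i s.
Proof.
move=> ls es me.
have [] := @lin_split (predC1 e) s ls.
  by move=> x y xs _ yx; apply/eqP => E; apply: (me x xs); rewrite -E.
suff -> : filter (predC (predC1 e)) s = [:: e] by rewrite cats1.
rewrite -(@filter_pred1_uniq _ s e) //; last by case: ls => /andP[].
by apply: eq_filter => x /=; rewrite negbK.
Qed.

(** [Bot] is comparable with every other valid event, so both events carry a transition, and
    dependence of the two would make the events [inc]. *)
Lemma lin_indep e e' : valid e -> valid e' -> e <> e' -> ~ inc e e' ->
    ~ cau e e' -> ~ cau e' e ->
  exists t t', [/\ lab e = [:: t], lab e' = [:: t'] & I t t'].
Proof.
move=> ve ve' ne ni nc nc'.
have [E|[t [H [E _ _]]]] := valid_inv ve.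
  by case: (cau_Bot ve') => [E'|]; [rewrite E E' in ne | rewrite -E].
have [E'|[t' [H' [E' _ _]]]] := valid_inv ve'.
  by case: (cau_Bot ve) => [E''|]; [rewrite E' E'' in ne | rewrite -E'].
exists t, t'; rewrite E E'; split=> //; apply: contrapT => dt.
by apply: ni; split=> //; exists t, t'; rewrite E E'.
Qed.

Lemma runs_enabled_cat t q r o o' : runs q = Some o -> runs (q ++ r) = Some o' ->
    (forall e u, e \in r -> lab e = [:: u] -> I u t) ->
  enabled M t o <-> enabled M t o'.
Proof.
move=> ro; rewrite /runs word_cat exec_cat [exec M (word q) _]ro /= => ro' ind.
apply: enabled_exec_indep ro' _; first exact: runs_reach ro.
move=> u /flattenP[l /mapP[e er ->]]; have := ind e^~ er.
by case: e er => //= v l' er; rewrite inE => /(_ v erefl) + /eqP ->.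
Qed.

(** An event of [p] outside [H] is incomparable with the last event, so dependence would make the
    two [inc]. *)
Lemma lin_rcons_indep p t H e u : lin (rcons p (Ev t H)) -> e \in p ->
  e \notin H -> lab e = [:: u] -> I u t.
Proof.
move=> /lin_rcons[lp nep ve ce me] ep eH ue; apply: contrapT => dut.
have [nc []] := me e ep; split=> //.
- by move=> E; rewrite -E ep in nep.
- by rewrite cau_Ev; apply/negP.
- by exists u, t.
Qed.

(** Strong induction on the size, in two stages: every linearization is executable ([total]); then
    two linearizations are compared through their last events, which commute when they differ. *)
Lemma lin_runs n s : size s = n -> lin s ->
  exists o, forall s', lin s' -> s' =i s -> runs s' = Some o.
Proof.
have [k] := ubnP n; elim: k n s => // k IHk n s; rewrite ltnS => nk sn ls.
have IH s1 : (size s1 < size s)%N -> lin s1 ->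
    exists o, forall s', lin s' -> s' =i s1 -> runs s' = Some o.
  by move=> lt1; apply: (IHk (size s1)) => //; rewrite (leq_trans lt1) // sn.
have sz s1 s2 : lin s1 -> lin s2 -> s1 =i s2 -> size s1 = size s2.
  by case=> /andP[u1 _] _ [/andP[u2 _] _] E; apply/perm_size/uniq_perm.
have total p e : lin (rcons p e) -> rcons p e =i s ->
    exists o, runs (rcons p e) = Some o.
  move=> lpe Epe; have spe := sz _ _ lpe ls Epe; rewrite size_rcons in spe.
  have /lin_rcons[lp ep ve ce me] := lpe.
  have [|op rop] := IH p _ lp; first by rewrite -spe.
  rewrite runs_rcons (rop p) //=.
  case/valid_inv: (ve) => [->|[t [H [E vH hH]]]]; first by exists op.
  (* List [H] first ([q]), then the rest [r] of [p]: [t] is enabled after [H] by the definition of a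
     history, and remains so after [r], whose events are independent of [t]. *)
  have [|lqr Eqr] := @lin_split (mem H) p lp.
    by case: hH => cH _ _ _ _ x y _ /=; apply: cH.
  set q := filter _ p in lqr Eqr; set r := filter _ p in lqr Eqr.
  have lq : lin q.
    by apply: lin_filter => // x y _ /=; case: hH => cH _ _ _ _; apply: cH.
  have Eq : q =i H.
    move=> x; rewrite mem_filter /=; apply: andb_idr => xH.
    by apply: ce; rewrite E.
  have [|oq roq] := IH q _ lq.
    by rewrite -spe ltnS size_filter count_size.
  case: hH => cH iH _ [sH [osH EH [oH roH en]]] _.
  have lH : lin sH.
    split=> //; split; first by move=> x /=; rewrite EH; apply: vH.
      by move=> x y /=; rewrite !EH; apply: cH.
    by move=> x y /=; rewrite !EH; apply: iH.
  (* The history enables [t] after its own linearization [sH]; by induction [q] reaches the same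
     state. *)
  have oqH : oq = oH.
    have : runs sH = Some oq by apply: roq => // x; rewrite EH Eq.
    by rewrite roH => -[].
  have : enabled M t op.
    apply/(@runs_enabled_cat t q r oH op); last exact: en.
    - by rewrite -oqH; apply: roq.
    - exact: rop.
    - move=> x u; rewrite mem_filter /= => /andP[xH xp].
      by apply: lin_rcons_indep xp xH; rewrite -E.
  by case=> o' st; exists o'; rewrite E /= st.
case/lastP: s sn ls IH sz total {IHk} => [|p1 e1] sn ls IH sz total.
  exists (init M) => s' ls' E; have -> : s' = [::] by apply/nilP; rewrite /nilp (sz _ _ ls' ls E).
  by [].
have [o ro] := total _ _ ls (fun=> erefl); exists o => s'.
case/lastP: s' => [|p2 e2] ls2 E2.
  by have := E2 e1; rewrite mem_rcons inE eqxx in_nil.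
have [o2 ro2] := total _ _ ls2 E2; rewrite ro2 -ro2 -ro.
have /lin_rcons[lp1 ep1 ve1 ce1 me1] := ls.
have /lin_rcons[lp2 ep2 ve2 ce2 me2] := ls2.
have s12 := sz _ _ ls2 ls E2; rewrite !size_rcons in s12; case: s12 => s12.
have IH' q : (size q <= size p1)%N -> lin q ->
    exists o, forall s', lin s' -> s' =i q -> runs s' = Some o.
  by move=> sq; apply: IH; rewrite size_rcons ltnS.
have [E|/eqP ne] := eqVneq e1 e2.
  have Ep : p2 =i p1.
    move=> x; have := E2 x; rewrite !mem_rcons !inE E.
    have [->|//] := eqVneq x e2.
    by move: ep1; rewrite E (negbTE ep2) => /negbTE->.
  have [//|o' ro'] := IH' p1 _ lp1.
  by rewrite !runs_rcons E (ro' p1) ?(ro' p2).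
(* Now [e1] and [e2] are distinct and both maximal, hence independent. With [r] the remaining
   events, [p1] is reordered as [rcons r e2] and [p2] as [rcons r e1], and the diamond at the state
   of [r] closes. *)
have e2p1 : e2 \in p1.
  have := E2 e2; rewrite !mem_rcons !inE eqxx /=; case: eqP => [E|//].
  by case: ne.
have e1p2 : e1 \in p2.
  by have := E2 e1; rewrite !mem_rcons !inE eqxx /=; case: eqP.
have me2' x : x \in p1 -> ~ cau e2 x.
  move=> xp1; have : x \in rcons p2 e2.
    by rewrite E2 mem_rcons inE xp1 orbT.
  rewrite mem_rcons inE => /orP[/eqP->|/me2[]//].
  by rewrite cau_irr.
have [lr2 Er2] := lin_last lp1 e2p1 me2'.
set r := filter _ p1 in lr2 Er2.
have /lin_rcons[lr e2r _ ce2r me2r] := lr2.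
have rp1 x : x \in r -> x \in p1 by rewrite mem_filter => /andP[].
have [c12 i12] := me1 _ e2p1; have [c21 _] := me2 _ e1p2.
have lr1 : lin (rcons r e1).
  apply/lin_rcons; split=> //.
  - by apply: contra ep1 => /rp1.
  - move=> x xe1; rewrite mem_filter ce1 //= andbT.
    by apply/eqP => E; apply: c21; rewrite -E.
  - by move=> x /rp1/me1.
have Er1 : rcons r e1 =i p2.
  move=> x; have := E2 x; have := Er2 x; rewrite !mem_rcons !inE => <-.
  have [->|_] := eqVneq x e2; last by [].
  move=> _; rewrite (negbTE ep2) (negbTE e2r) orbF.
  by apply/negbTE/eqP => E; apply: ne.
have [t2 [t1 [l2 l1 i21]]] : exists t2 t1, [/\ lab e2 = [:: t2], lab e1 = [:: t1] & I t2 t1].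
  by apply: lin_indep => // E; apply: ne.
have [//|o1 ro1] := IH' p1 _ lp1.
have [|o2' ro2'] := IH' p2 _ lp2; first by rewrite s12.
have [|or ror] := IH' r _ lr; first by rewrite size_filter count_size.
have := ro1 _ lr2 Er2; have := ro2' _ lr1 Er1.
rewrite !runs_rcons (ror r) // (ro1 p1) // (ro2' p2) // l1 l2 /=.
have [_ com] : Defs.commute M t2 t1 or.
  by case: indep => _ _; apply=> //; apply: (@runs_reach r); apply: ror.
case S1: (step M t1 or) => [x1|] //= [<-]; case S2: (step M t2 or) => [x2|] //= [<-].
have [||o3 /= []] := com; [by exists x2 | by exists x1 |].
by rewrite S1 S2 /= => -> ->.
Qed.

(** * Linearizations, their words and runs *)

Lemma lin_rcons_Bot p e : lin (rcons p e) -> (e = Bot <-> p = [::]).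
Proof.
move=> /lin_rcons[[_ [vp _ _]] ep ve ce me]; split=> [E|E].
  (* An event [x] listed before [Bot] would either be [Bot] or have it as a cause. *)
  case: p ep vp me {ce} => // x p ep vp me.
  have xp : x \in x :: p by rewrite inE eqxx.
  case: (cau_Bot (vp _ xp)) => [xE|Bx].
    by rewrite E -xE xp in ep.
  by case: (me _ xp); rewrite E.
by case: (cau_Bot ve) => [//|/ce]; rewrite E.
Qed.

(** The forced history: the causal closure in [p] of the events dependent on [t]. [Bot] is added by
    hand, to cover the case where no event of [p] is dependent on [t]. *)
Definition past p t x : Prop :=
  x \in p /\ (x = Bot \/
    exists y u, [/\ y \in p, x = y \/ cau x y, lab y = [:: u] & ~ I u t]).

(* A configuration determines the history of any event labelled [t] that
   extends it, so the word of a linearization determines the linearization. *)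
Lemma history_past p t H x : lin (rcons p (Ev t H)) -> x \in H <-> past p t x.
Proof.
move=> lpe; have /lin_rcons[lp ep ve ce me] := lpe.
have [vH [cH _ nH _ mH]] := valid_EvE ve.
split=> [xH|[xp [E|[y [u [yp xy ly dep]]]]]].
- split; first exact: ce.
  case: mH => [E|mH]; first by left; apply/eqP; rewrite E inE in xH.
  right; have [m [mH' xm max]] := cau_maximal t vH xH.
  by have [u lu dep] := mH m mH' max; exists m, u; split=> //; apply: ce.
- have [//|[z zH]] := fset_0Vmem H.
  by rewrite E; apply: (Bot_closed cH) (vH z zH).
- have yH : y \in H.
    by apply: contrapT => /negP yH; apply: dep; apply: lin_rcons_indep lpe yp yH ly.
  by case: xy => [->//|]; apply: cH.
Qed.

(** The last letter gives the transition of the last event, induction gives equal predecessors, and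
    [history_past] then gives equal histories. Nonemptiness separates [[::]] from [[:: Bot]], which
    share the empty word. *)
Lemma lin_word_inj s1 s2 : lin s1 -> lin s2 -> s1 <> [::] -> s2 <> [::] ->
  word s1 = word s2 -> s1 = s2.
Proof.
elim/last_ind: s1 s2 => // p1 e1 IH s2; case/lastP: s2 => // p2 e2 l1 l2 _ _.
have [B1 B1'] := lin_rcons_Bot l1; have [B2 B2'] := lin_rcons_Bot l2.
have /lin_rcons[lp1 _ ve1 _ _] := l1; have /lin_rcons[lp2 _ ve2 _ _] := l2.
rewrite !word_rcons.
have [E1|[t1 [H1 [E1 _ _]]]] := valid_inv ve1;
    have [E2|[t2 [H2 [E2 _ _]]]] := valid_inv ve2; rewrite E1 E2 /=.
- by rewrite (B1 E1) (B2 E2).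
- by rewrite (B1 E1) cats1; case: (word p2).
- by rewrite (B2 E2) cats1; case: (word p1).
rewrite !cats1 => /rcons_inj[wE tE].
have pE : p1 = p2.
  by apply: IH => // [/B1'|/B2']; rewrite ?E1 ?E2.
rewrite -pE -tE; congr (rcons _ (Ev _ _)); apply/fsetP => x.
rewrite E1 in l1; rewrite E2 -pE -tE in l2.
by apply/idP/idP; rewrite (history_past x l1) (history_past x l2).
Qed.

(** The witness is [past s t], the only candidate that [history_past] allows. *)
Lemma lin_extend s o t : lin s -> s <> [::] -> runs s = Some o ->
  enabled M t o -> exists H, lin (rcons s (Ev t H)).
Proof.
move=> ls s0 rs en; pose P x := `[<past s t x>].
exists [fset x | x in s & P x]%fset; set H := [fset x | x in s & P x]%fset.
have inH x : x \in H <-> past s t x.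
  rewrite !inE /=; split=> [/andP[_ /asboolP//]|px].
  by apply/andP; split; [case: px | apply/asboolP].
have Hs x : x \in H -> x \in s by move=> /inH[].
have depH x u : x \in s -> lab x = [:: u] -> ~ I u t -> x \in H.
  move=> xs lx dep; apply/inH; split=> //; right.
  by exists x, u; split=> //; left.
have [os [vs cs is_]] := ls.
have Bs : Bot \in s.
  case: s s0 vs cs {rs ls P H inH Hs depH os is_} => // x s _ vs cs.
  have xs : x \in x :: s by rewrite inE eqxx.
  exact: (Bot_closed cs xs (vs x xs)).
have BH : Bot \in H by apply/inH; split=> //; left.
have cH : down_closed [set` H].
  move=> x z /= /inH[xs px] zx; apply/inH; split; first exact: cs zx.
  case: px => [E|[y [u [ys xy ly dep]]]]; first by rewrite E in zx.
  right; exists y, u; split=> //; right; case: xy => [<-//|xy].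
  by apply: cau_trans xy => //; apply: vs.
have cP x z : x \in s -> P x -> cau z x -> P z.
  by move=> xs /asboolP /inH xH /(cH _ _ xH) zH; apply/asboolP/inH.
have eH : Ev t H \notin H by rewrite -(cau_Ev _ t) cau_irr.
(* If it occurred in [s], its label [t], dependent on itself by irreflexivity of [I], would put it
   into its own history. *)
have es : Ev t H \notin s.
  by apply: contra eH => es; apply: depH es _ _ => //; case: indep.
have ve : valid (Ev t H).
  apply: valid_Ev; first by move=> x /Hs/vs.
  split=> //.
  - by move=> a b /Hs + /Hs; apply: is_.
  - by move=> E; rewrite E inE in BH.
  (* The events of [s] outside [H] are independent of [t], so enabledness at the end of [s]
     transfers back to the state of [H]. *)
  - have lq := lin_filter ls cP; have [lqr Eqr] := lin_split ls cP.
    exists (filter P s); split; first by case: lq.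
      by move=> x; rewrite mem_filter !inE /= andbC.
    have [oq /(_ _ lq)/(_ (fun=> erefl)) roq] := lin_runs erefl lq.
    exists oq => //; have [os' h] := lin_runs erefl ls.
    have Eo : os' = o by have := h s ls (fun=> erefl); rewrite rs => -[].
    apply/(@runs_enabled_cat t _ (filter (predC P) s) oq os').
    + exact: roq.
    + exact: h.
    + move=> e u; rewrite mem_filter /= => /andP[/negP nPe e_s] le.
      apply: contrapT => dep; apply: nPe; apply/asboolP/inH.
      exact: depH le dep.
    + by rewrite Eo.
  (* If [H] has a member other than [Bot], a maximal [e] is not [Bot], so some [z] dependent on [t]
     equals or follows [e]; [z] lies in [H], and maximality gives [z = e]. *)
  - have [E|/existsNP[y /not_implyP[yH /eqP yB]]] :=
        pselect (forall y, y \in H -> y = Bot).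
      left; apply/fsetP => x; rewrite [RHS]in_fset1.
      by apply/idP/eqP => [/E|->].
    right=> e eH' max; have [e_s [eB|[z [u [zs ez lz dep]]]]] := (inH e).1 eH'.
      have [yE|By] := cau_Bot (vs _ (Hs _ yH)); first by rewrite yE eqxx in yB.
      by case: (max _ yH); rewrite eB.
    have zH := depH z u zs lz dep.
    by case: ez => [->|/max//]; exists u.
apply/lin_rcons; split=> //.
move=> x xs; split; first by move=> /(cs _ _ xs) /= es'; rewrite es' in es.
case=> _ nc _ [u [t' [lx [<-] dep]]]; apply: nc; rewrite cau_Ev.
exact: depH lx dep.
Qed.

Lemma lin_Bot : lin [:: Bot].
Proof.
split=> //; split.
- by move=> e /=; rewrite inE => /eqP->; apply: valid_Bot.
- by move=> e x /=; rewrite inE => /eqP->.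
- by move=> a b /=; rewrite !inE => /eqP-> /eqP-> [].
Qed.

Lemma run_lin w : is_run M w -> exists s, [/\ lin s, s <> [::] & word s = w].
Proof.
elim/last_ind: w => [_|w t IH [o]].
  by exists [:: Bot]; split; first exact: lin_Bot.
rewrite -cats1 exec_cat; case E: (exec M w _) => [o1|] //= st.
have [|s [ls s0 ws]] := IH; first by exists o1.
have [||H lsH] := @lin_extend s o1 t ls s0; first by rewrite /runs ws.
  by case Et: (step M t o1) st => [o2|] // _; exists o2.
exists (rcons s (Ev t H)); split=> //; last by rewrite word_rcons ws.
by move=> s1; have := congr1 size s1; rewrite size_rcons.
Qed.

(** * Prefixes as causally closed sets of events *)

(** Closed form of inherited conflict: causality is transitive on valid events, so descending once
    on each side replaces the inductive closure. *)
Definition cf a b : Prop := exists a' b',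
  [/\ a' = a \/ cau a' a, b' = b \/ cau b' b & inc a' b'].

Lemma cfC a b : cf a b -> cf b a.
Proof. by case=> a' [b' [? ? /incC]]; exists b', a'. Qed.

Lemma cf_down a b c : valid c -> cf a b -> cau b c -> cf a c.
Proof.
move=> vc [a' [b' [aa bb ab]]] bc; exists a', b'; split=> //; right.
by case: bb => [->//|b'b]; apply: cau_trans bc.
Qed.

Lemma cf_irr e : valid e -> ~ cf e e.
Proof.
case/valid_inv => [->|[t [H [-> vH [_ iH _ _ _]]]]] [a [b [aE bE ab]]].
  by case: ab => ne _ _ _; case: aE bE ne => [->|//] [->|].
by case: aE bE ab => [->|aH] [->|bH] [] // *; apply: (iH a b).
Qed.

Definition prefix_events D : Prop :=
  [/\ D Bot, forall e, D e -> valid e & down_closed D].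

Notation ules := (les (event T) (seq T)).
Implicit Types (X Y : ules).

(** Kept apart from [canonical] because causality and labels already determine
    [incomparable_dependent], from which the conflict of an extension or a union is then
    computed. *)
Definition preprefix X : Prop :=
  [/\ prefix_events (events X),
      forall a b, causality X a b <-> events X b /\ cau a b
    & forall e, label X e = if `[<events X e>] then Some (lab e) else None].

(* Causality, labels and conflict depend only on the raw terms, so that a
   prefix is determined by its set of events. *)
Definition canonical X : Prop :=
  preprefix X /\
  forall a b, conflict X a b <-> [/\ events X a, events X b & cf a b].

Lemma canonical_ex D : prefix_events D -> exists X, canonical X /\ events X = D.
Proof.
move=> [DB Dv Dc].
pose ca a b := D b /\ cau a b; pose cn a b := [/\ D a, D b & cf a b].
pose la e := if `[<D e>] then Some (lab e) else None.
have h1 a b : ca a b -> D a /\ D b by case=> Db ab; split=> //; apply: Dc ab.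
have h2 a b : cn a b -> D a /\ D b by case.
have h3 e : D e <-> la e <> None by rewrite /la; case: asboolP.
have h4 e : ~ ca e e by case; rewrite cau_irr.
have h5 a b c : ca a b -> ca b c -> ca a c.
  by move=> [Db ab] [Dc' bc]; split=> //; apply: cau_trans bc => //; apply: Dv.
have h6 e : finite_set [set x | ca x e].
  case: (pselect (D e)) => [/Dv/valid_inv[->|[t [H [-> _ _]]]]|nD].
  - by apply: (sub_finite_set (B := set0)) => // x [].
  - by apply: (sub_finite_set (B := [set` H])) => // x [].
  - by apply: (sub_finite_set (B := set0)) => // x [].
have h7 e : ~ cn e e by case=> De _; apply: cf_irr; apply: Dv.
have h8 a b : cn a b -> cn b a by case=> Da Db /cfC.
have h9 a b c : cn a b -> ca b c -> cn a c.
  move=> [Da Db ab] [Dc' bc]; split=> //; apply: cf_down ab bc; exact: Dv.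
by exists (Les h1 h2 h3 h4 h5 h6 h7 h8 h9).
Qed.

Lemma canonical_eq X Y :
  canonical X -> canonical Y -> events X = events Y -> X = Y.
Proof.
move=> [[_ cX lX] fX] [[_ cY lY] fY] eXY.
have cE : causality X = causality Y.
  by apply: funext => a; apply: funext => b; apply: propext; rewrite cX cY eXY.
have fE : conflict X = conflict Y.
  by apply: funext => a; apply: funext => b; apply: propext; rewrite fX fY eXY.
have lE : label X = label Y by apply: funext => e; rewrite lX lY eXY.
case: X Y {cX lX fX cY lY fY} eXY cE fE lE => [eX cX fX lX ? ? ? ? ? ? ? ? ?].
case=> [eY cY fY lY ? ? ? ? ? ? ? ? ?] /= E1 E2 E3 E4.
by subst eY cY fY lY; congr Les; apply: Prop_irrelevance.
Qed.

Lemma canonical_prefix X Y : canonical X -> canonical Y ->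
  events X `<=` events Y -> prefix_of X Y.
Proof.
move=> [[[_ _ dX] cX lX] fX] [[_ cY lY] fY] sXY; split=> //.
- move=> a b; split=> [/cX[Xb ab]|[Xa Xb /cY[_ ab]]]; last exact/cX.
  by split; [apply: dX ab | | apply/cY; split=> //; apply: sXY].
- move=> a b; split=> [/fX[Xa Xb ab]|[Xa Xb /fY[_ _ ab]]]; last exact/fX.
  by split=> //; apply/fY; split=> //; apply: sXY.
- move=> e Xe; rewrite lX lY; case: asboolP => // _.
  by case: asboolP => // -[]; apply: sXY.
- by move=> a b Xa; rewrite cY => -[_]; apply: dX.
Qed.

(** Serves both extensions and unions, whose base relations [R] differ. The final disjunction is for
    extensions, where the added pairs list the new event first. *)
Lemma conflict_closure_cf D (lt R : event T -> event T -> Prop) :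
    prefix_events D -> (forall a b, lt a b <-> D b /\ cau a b) ->
    (forall a b, R a b -> [/\ D a, D b & cf a b]) ->
    (forall a b, D a -> D b -> inc a b -> R a b \/ R b a) ->
  forall a b, conflict_closure lt R a b <-> [/\ D a, D b & cf a b].
Proof.
move=> [_ Dv Dc] ltE Rcf incR a b; split.
  elim=> {a b} [a b /Rcf//|a b _ [Da Db /cfC]//|a b c _ [Da Db ab]].
  by move=> /ltE[Dc' bc]; split=> //; apply: cf_down ab bc; apply: Dv.
move=> [Da Db [a' [b' [aa bb ab]]]].
have Da' : D a' by case: aa => [->//|]; apply: Dc.
have Db' : D b' by case: bb => [->//|]; apply: Dc.
have base : conflict_closure lt R a' b'.
  have [r|r] := incR _ _ Da' Db' ab; first exact: conflict_base.
  by apply/conflict_swap/conflict_base.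
(* Inheritance acts on the second argument, so [b] is reached first and [a] after a swap. *)
have up : conflict_closure lt R a' b.
  by case: bb => [<-//|bb]; apply: conflict_down base _; apply/ltE.
case: aa => [<-//|aa]; apply: conflict_swap.
by apply: conflict_down (conflict_swap up) _; apply/ltE.
Qed.

Lemma incomparable_dependentE X a b : preprefix X ->
  incomparable_dependent I X a b <-> [/\ events X a, events X b & inc a b].
Proof.
move=> [_ cX lX]; split.
  move=> [Xa Xb nab nba [t [u []]]]; rewrite !lX !asboolT // => -[la] [lb] dep.
  split=> //; split.
  - by move=> E; apply: nab; right.
  - by move=> ab; apply: nba; left; apply/cX.
  - by move=> ba; apply: nab; left; apply/cX.
  - by exists t, u.
move=> [Xa Xb [ne nab nba [t [u [la lb dep]]]]]; split=> //.
- by case=> [/cX[]//|/= E]; apply: ne.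
- by case=> [/cX[]//|/= E]; apply: ne.
- by exists t, u; rewrite !lX !asboolT // la lb.
Qed.

(** Every member of [C] has a label, so [pmap] discards nothing, and the index condition becomes the
    pairwise one. *)
Lemma interE X (C : {fset event T}) w : preprefix X ->
    (forall x, x \in C -> events X x) ->
  inter X C w <-> exists s, [/\ ordered s, s =i C & w = word s].
Proof.
move=> [_ cX lX] CX.
have wE s : s =i C -> flatten (pmap (label X) s) = word s.
  move=> sC; have : {subset s <= C} by move=> x; rewrite sC.
  rewrite /word {sC}; elim: s => //= x s IH sC.
  rewrite {1}lX asboolT /=; last by apply/CX/sC; rewrite inE eqxx.
  by rewrite IH // => y ys; apply: sC; rewrite inE ys orbT.
split=> [[s [us sC os ->]]|[s [/andP[us os] sC ->]]]; exists s.
  split=> //; last exact: wE.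
  rewrite /ordered us; apply/(pairwiseP Bot) => i j; rewrite !inE => li lj ij.
  apply/negP => ji; have Ci : nth Bot s i \in C by rewrite -sC mem_nth.
  have := os (nth Bot s j) (nth Bot s i).
  rewrite -!sC !mem_nth // !index_uniq // => /(_ isT isT).
  by rewrite ltnNge (ltnW ij) => /(_ _)/notF; apply; apply/cX; split=> //; apply: CX.
split; rewrite ?wE // => a b aC bC /cX[_ ab].
rewrite -sC in aC; rewrite -sC in bC.
rewrite ltnNge leq_eqVlt; apply/negP => /orP[/eqP E|lt].
  by move: ab; rewrite -(nth_index Bot aC) -E nth_index // cau_irr.
have := pairwiseP Bot os (index b s) (index a s).
by rewrite !inE !index_mem => /(_ bC aC lt); rewrite !nth_index // ab.
Qed.

(** The two sources of a conflict inside [C] lie in [C] by causal closure. *)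
Lemma configurationE X C : canonical X ->
  configuration X C <-> [/\ forall x, x \in C -> events X x,
                            down_closed [set` C] & inc_free [set` C]].
Proof.
move=> [pX fX]; have [[_ _ dX] cX lX] := pX.
split=> [[CX dC fC]|[CX dC fC]]; split=> //.
- by move=> e x /= eC xe; apply: dC (eC) _; apply/cX; split=> //; apply: CX.
- move=> a b /= aC bC ab; apply: (fC _ _ aC bC); apply/fX.
  by split; [apply: CX | apply: CX | exists a, b; split=> //; left].
- by move=> a b aC /cX[_]; apply: dC.
- move=> a b aC bC /fX[_ _ [a' [b' [aa bb]]]]; apply: fC => /=.
    by case: aa => [->//|]; apply: dC.
  by case: bb => [->//|]; apply: dC.
Qed.

(** The structure enters through its set of events alone, so a history remains a candidate in any
    canonical structure containing its members. *)
Lemma candidate_historyE X t H : canonical X ->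
  candidate_history M I X t H <->
  (forall x, x \in H -> events X x) /\ history t H.
Proof.
move=> cX; have [pX fX] := cX; have [_ ltX lX] := pX; split.
  move=> [/(configurationE _ cX)[HX dH iH] nH [o [w wi wo] en] mH].
  split=> //; split=> //.
    have /(interE w pX HX)[s [os sH wE]] := wi.
    by exists s; split=> //; exists o; rewrite // /runs -wE.
  case: mH => [|mH]; [by left | right=> e eH me].
  have [|u] := mH e; first by split=> // x xH /ltX[_]; apply: me.
  by rewrite lX asboolT; [move=> -[le] dep; exists u | apply: HX].
move=> [HX [dH iH nH [s [os sH [o so en]]] mH]]; split=> //.
- exact/configurationE.
- by exists o => //; exists (word s) => //; apply/interE => //; exists s.
- case: mH => [|mH]; [by left | right=> e [eH me]].
  have [|u le dep] := mH e eH.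
    by move=> x xH ex; apply: (me x xH); apply/ltX; split=> //; apply: HX.
  by exists u => //; rewrite lX asboolT; [rewrite le | apply: HX].
Qed.

(** * Unfolding prefixes are the canonical structures *)

Lemma canonical_finite_prefix X : finite_unfolding_prefix M I X -> canonical X.
Proof.
elim=> {X} [X [eX cX fX lX]|X t H Y _ cX /(candidate_historyE _ _ cX)].
  have D : prefix_events (events X).
    rewrite eX; split=> //; first by move=> _ ->; apply: valid_Bot.
    by move=> _ x ->.
  split.
    split=> // [a b|e].
      by split=> [/cX//|[]]; rewrite eX => ->.
    have := label_events X e; rewrite eX; case: asboolP => [->//|].
    by case: (label X e) => // l ne h; case: ne; apply/h.
  move=> a b; split=> [/fX//|[]]; rewrite eX => -> ->.
  by move/(cf_irr valid_Bot).
move=> [HX hH] [_ eY cY fY lY].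
have [[[XB Xv Xd] ltX lX] fX] := cX.
have ve : valid (Ev t H) by apply: valid_Ev => // x /HX/Xv.
have D : prefix_events (events Y).
  rewrite eY; split; first by left.
    by move=> e [/Xv//|->].
  by move=> e x [Xe xe|-> /= xH]; left; [apply: Xd xe | apply: HX].
have cauY a b : causality Y a b <-> events Y b /\ cau a b.
  rewrite cY ltX eY; split.
    by case=> [[Xb ab]|[aH ->]]; split=> //; [left | right].
  by case=> -[Xb|->] ab; [left | right].
have pY : preprefix Y.
  split=> // e; rewrite lY lX eY; have [->|ne] := eqVneq.
    by rewrite asboolT //; right.
  congr (if _ then _ else _); apply: asbool_equiv_eq; split; first by left.
  by case=> // E; rewrite E eqxx in ne.
split=> // a b; rewrite fY; move: a b; apply: conflict_closure_cf => //.
  move=> a b [/fX[Xa Xb ab]|[_ /(incomparable_dependentE _ _ pY)[Ya Yb ab]]].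
    by split=> //; rewrite eY; left.
  by split=> //; exists a, b; split=> //; left.
(* A pair involving the new event is added by the extension in one of its two orders; any other pair
   was in conflict in [X] already. *)
move=> a b Ya Yb ab.
have [aE|aE] := pselect (a = Ev t H).
  by left; right; split=> //; apply/incomparable_dependentE.
have [bE|bE] := pselect (b = Ev t H).
  by right; right; split=> //; apply/incomparable_dependentE => //; split=> //; apply: incC.
left; left; apply/fX; move: Ya Yb; rewrite eY => -[Xa|//] [Xb|//].
by split=> //; exists a, b; split=> //; left.
Qed.

Lemma canonical_unfolding_prefix X : unfolding_prefix M I X -> canonical X.
Proof.
elim=> {X} [X|F Y infF _ cF [eY ltY fY lY]]; first exact: canonical_finite_prefix.
have eYP e : events Y e <-> exists2 X, F X & events X e.
  by rewrite eY; split=> -[X FX Xe]; exists X.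
have D : prefix_events (events Y).
  split.
  - have [X FX] := infinite_setN0 infF; apply/eYP; exists X => //.
    by case: (cF X FX) => -[[]].
  - by move=> e /eYP[X FX]; case: (cF X FX) => -[[_ + _] _ _] _; apply.
  - move=> e x /eYP[X FX Xe] xe; apply/eYP; exists X => //.
    by case: (cF X FX) => -[[_ _ dX] _ _] _; apply: dX xe.
have cauY a b : causality Y a b <-> events Y b /\ cau a b.
  rewrite ltY eYP; split=> [[X FX]|[[X FX Xb] ab]].
    by case: (cF X FX) => -[_ -> _] _ [Xb ab]; split=> //; exists X.
  by exists X => //; case: (cF X FX) => -[_ -> _] _.
have pY : preprefix Y.
  split=> // e; case: asboolP => [/eYP[X FX Xe]|nYe].
    apply/lY; exists X => //.
    by case: (cF X FX) => -[_ _ ->] _; rewrite asboolT.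
  by apply: contrapT => /label_events.
split=> // a b; rewrite fY; move: a b; apply: conflict_closure_cf => //.
  move=> a b /(incomparable_dependentE _ _ pY)[Ya Yb ab].
  by split=> //; exists a, b; split=> //; left.
by move=> a b Ya Yb ab; left; apply/incomparable_dependentE.
Qed.

(** Induction on the number of events: a causally maximal event other than [Bot] is removed, and [X]
    is the extension by it of what remains. *)
Lemma finite_prefix_canonical X : canonical X -> finite_set (events X) ->
  finite_unfolding_prefix M I X.
Proof.
move=> cX /finite_fsetP[A XA]; have [k] := ubnP #|` A|.
elim: k A X cX XA => // k IH A X cX XA lek.
have [pX fX] := cX; have [[XB Xv Xd] ltX lX] := pX.
have XAE x : events X x <-> x \in A by rewrite XA.
have [allB|] := pselect (forall e, events X e -> e = Bot).
  apply: finite_prefix_bottom.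
  have XE : events X = [set Bot].
    by apply/seteqP; split=> [e /allB//|_ ->].
  split=> //.
  - by move=> a b /ltX[/allB->].
  - by move=> a b /fX[/allB-> /allB->]; apply: cf_irr valid_Bot.
  - by rewrite lX asboolT.
move=> /existsNP[e /not_implyP[Xe eB]].
have [//|[t0 [H0 [eE _ _]]]] := valid_inv (Xv _ Xe).
(* Climbing from [e], which is not [Bot], ensures that [m] is not [Bot] either. *)
have [|m [mA em max]] := @cau_maximal A t0 e _ ((XAE e).1 Xe).
  by move=> x /XAE/Xv.
have vm : valid m by apply/Xv/XAE.
have [mB|[t [H [mE vH hH]]]] := valid_inv vm.
  by case: em; rewrite mB.
pose D := events X `\ m.
have Dx x : D x <-> events X x /\ x <> m by [].
have pD : prefix_events D.
  split; first by split=> // E; rewrite -E in mE.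
    by move=> x [/Xv].
  move=> x y [Xx xm] yx; split; first exact: Xd yx.
  by move=> E; apply: (max x) => //; [apply/XAE | rewrite -E].
have [X' [cX' X'D]] := canonical_ex pD.
have [[_ ltX' lX'] fX'] := cX'.
have HD x : x \in H -> D x.
  move=> xH; have xm : cau x m by rewrite mE.
  split; first by apply: Xd xm; apply/XAE.
  by move=> E; rewrite E cau_irr in xm.
apply: (@finite_prefix_extend _ _ _ _ X' t H).
- apply: (IH (A `\ m)%fset) => //.
    rewrite X'D; apply/seteqP; split=> x /=; rewrite !inE.
      by move=> [/XAE-> /eqP->].
    by move=> /andP[/eqP xm /XAE Xx].
  by move: lek; rewrite (cardfsD1 m A) mA.
- by apply/candidate_historyE => //; rewrite X'D.
rewrite /is_extension -mE; split.
- by rewrite X'D => -[_ []].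
- rewrite X'D; apply/seteqP; split=> x.
    by move=> Xx; have [->|xm] := pselect (x = m); [right | left].
  by case=> [[]//|->]; apply/XAE.
- move=> a b; rewrite ltX ltX' X'D; split=> [[Xb ab]|].
    have [bm|bm] := pselect (b = m); last by left.
    by right; split=> //; move: ab; rewrite bm mE.
  by case=> [[[Xb _] ab]//|[aH ->]]; split; [apply/XAE | rewrite mE].
- move=> a b; rewrite fX; apply: iff_sym; move: a b.
  apply: conflict_closure_cf => //.
    move=> a b [/fX'|[_ /(incomparable_dependentE _ _ pX)]].
      by rewrite X'D => -[[Xa _] [Xb _]].
    by case=> Xa Xb ab; split=> //; exists a, b; split=> //; left.
  move=> a b Xa Xb ab.
  have [am|am] := pselect (a = m).
    by left; right; split=> //; apply/incomparable_dependentE.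
  have [bm|bm] := pselect (b = m).
    right; right; split=> //; apply/incomparable_dependentE => //.
    by split=> //; apply: incC.
  left; left; apply/fX'; rewrite X'D; split=> //.
  by exists a, b; split=> //; left.
- move=> x; rewrite lX lX' X'D; have [->|/eqP xm] := eqVneq.
    by rewrite asboolT; [rewrite mE | apply/XAE].
  congr (if _ then _ else _); apply: asbool_equiv_eq.
  by split=> [Xx|[]].
Qed.

Lemma unfolding_prefix_canonical X : canonical X -> unfolding_prefix M I X.
Proof.
move=> cX; have [finX|infX] := pselect (finite_set (events X)).
  by apply: unfolding_prefix_finite; apply: finite_prefix_canonical.
have [pX fX] := cX; have [[XB Xv Xd] ltX lX] := pX.
pose F : set ules := [set Y | [/\ canonical Y, finite_set (events Y) &
                                  events Y `<=` events X]].
(* The witness is the canonical structure on the local configuration of [e], finite because it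
   consists of [e] and its history. *)
have cover e : events X e -> exists2 Y, F Y & events Y e.
  move=> Xe.
  have pD : prefix_events [set x | x = e \/ cau x e].
    split=> /=.
    - by case: (cau_Bot (Xv _ Xe)); [left | right].
    - by move=> x [->|/valid_cau]; last apply; apply: Xv.
    - move=> x y [->|xe] yx; right => //.
      by apply: cau_trans xe => //; apply: Xv.
  have [Y [cY YD]] := canonical_ex pD; exists Y; last by rewrite YD; left.
  split=> //; rewrite YD.
    have [->|[t [H [-> _ _]]]] := valid_inv (Xv _ Xe).
      by apply: (sub_finite_set (B := [set Bot])) => // x [].
    apply: (sub_finite_set (B := [set` (Ev t H |` H)%fset])) => // x /=.
    by rewrite !inE => -[->|->]; rewrite ?eqxx ?orbT.
  by move=> x [->//|]; apply: Xd.
apply: (@unfolding_prefix_union _ _ _ _ F).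
(* Finitely many finite sets cannot cover infinitely many events. *)
- move=> finF; apply: infX.
  apply: (sub_finite_set (B := \bigcup_(Y in F) events Y)).
    by move=> e /cover[Y FY Ye]; exists Y.
  by apply: bigcup_finite => // Y [].
- move=> Y [cY finY _]; apply: unfolding_prefix_finite.
  exact: finite_prefix_canonical.
split.
- apply/seteqP; split=> [e /cover[Y FY Ye]|e [Y [_ _ YX]] /YX//].
  by exists Y.
- move=> a b; rewrite ltX; split=> [[Xb ab]|[Y [[[_ ltY _] _] _ YX]]].
    have [Y FY Yb] := cover _ Xb; exists Y => //.
    by case: FY => -[[_ -> _] _].
  by rewrite ltY => -[/YX].
- move=> a b; rewrite fX; apply: iff_sym; move: a b.
  apply: conflict_closure_cf => //.
    move=> a b /(incomparable_dependentE _ _ pX)[Xa Xb ab].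
    by split=> //; exists a, b; split=> //; left.
  by move=> a b Xa Xb ab; left; apply/incomparable_dependentE.
- move=> e l; rewrite lX; case: asboolP => [Xe|nXe]; split=> //; first move=> [<-].
  + have [Y FY Ye] := cover _ Xe; exists Y => //.
    by case: FY => -[[_ _ ->] _] _ _; rewrite asboolT.
  + by move=> [Y [[[_ _ lY] _] _ _]]; rewrite lY; case: asboolP.
  + move=> [Y [[[_ _ lY] _] _ YX]]; rewrite lY; case: asboolP => // /YX.
    by move/nXe.
Qed.

(** * The unfolding *)

Lemma valid_prefix_events : prefix_events [set e | valid e].
Proof. by split=> //= [|e x]; [apply: valid_Bot | apply: valid_cau]. Qed.

Lemma unfolding_ex : exists U : ules,
  unique (maximal_prefix (unfolding_prefix M I)) U /\
  forall w : seq T, is_run M w -> w <> [::] ->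
    exists! C : {fset event T}, configuration U C /\ inter U C w.
Proof.
have [U [cU UE]] := canonical_ex valid_prefix_events.
(* Thus [U] is the greatest unfolding prefix, which yields both its maximality and its
   uniqueness. *)
have sub X : canonical X -> events X `<=` events U.
  by move=> [[[_ Xv _] _ _] _] e /Xv; rewrite UE.
have PU := unfolding_prefix_canonical cU.
exists U; split.
  split.
    split=> // Y /canonical_unfolding_prefix cY [UY _ _ _ _].
    by apply: canonical_eq => //; apply/seteqP; split=> //; apply: sub.
  move=> X [/canonical_unfolding_prefix cX max]; apply: max => //.
  by apply: canonical_prefix => //; apply: sub.
(* A configuration together with one of its words amounts to a linearization: existence then comes
   from [run_lin] and uniqueness from [lin_word_inj]. *)
have linC C w : configuration U C /\ inter U C w <->
    exists s, [/\ lin s, s =i C & w = word s].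
  rewrite (configurationE _ cU); split.
    move=> [[CU dC iC] /(interE _ (proj1 cU) CU)[s [os sC ->]]].
    exists s; split=> //; split=> //; split.
    - by move=> x /=; rewrite sC => /CU; rewrite UE.
    - by move=> x y /=; rewrite !sC; apply: dC.
    - by move=> a b /=; rewrite !sC; apply: iC.
  move=> [s [[os [vs ds is_]] sC ->]].
  have CU x : x \in C -> events U x by rewrite UE -sC; apply: vs.
  split; last by apply/(interE _ (proj1 cU) CU); exists s.
  split=> //.
  - by move=> x y /=; rewrite -!sC; apply: ds.
  - by move=> a b /=; rewrite -!sC; apply: is_.
move=> w /run_lin[s [ls s0 sw]] w0.
exists [fset x | x in s]%fset; split.
  by apply/linC; exists s; split=> // x; rewrite !inE.
move=> C /linC[s' [ls' s'C ws']]; apply/fsetP => x; rewrite !inE /= -s'C.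
rewrite (lin_word_inj ls ls') // ?sw //.
by move=> E; rewrite ws' E in w0.
Qed.

End Prefixes.

Theorem theorem1 (St : Type) (T : choiceType) (M : system St T)
    (I : T -> T -> Prop)
    (finite_reach : finite_set (reach M))
    (indep : unconditional_independence M I) :
  exists U : les (event T) (seq T),
    unique (maximal_prefix (unfolding_prefix M I)) U /\
    forall w : seq T, is_run M w -> w <> [::] ->
      exists! C : {fset event T}, configuration U C /\ inter U C w.
Proof. exact: unfolding_ex indep. Qed.
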